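(* (i) If $r\in\{3,4\}$ and $n\ge r+1$, then $t_2(n,r)\le \frac{5}{2}n-5$. (ii) If $r=5$ and $n\ge 7$, then $t_2(n,5)\le \frac{7n-19}{3}$. (iii) If $6\le r\le n-3$, then $t_2(n,r)\le 2n-r+2$.
   Context: All graphs are finite, simple and undirected. An $r$-colouring of a graph $G$ is a function $c:E(G)\to\{1,\dots,r\}$ (not necessarily proper). A path is rainbow if all its edges have distinct colours. For a $2$-connected graph $G$, a colouring is rainbow $2$-connected if every two vertices of $G$ are connected by two internally vertex-disjoint rainbow paths, and the rainbow $2$-connection number $rc_2(G)$ is the minimum number of colours in a rainbow $2$-connected colouring of $G$. For integers $n$ and $r\ge 1$, $t_2(n,r)$ denotes the minimum number of edges in a $2$-connected graph $G$ on $n$ vertices with $rc_2(G)\le r$. *)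

(* Defs.v *)
From HB Require Import structures.
From mathcomp Require Import all_boot all_order all_algebra.
Set Implicit Arguments.
Unset Strict Implicit.
Unset Printing Implicit Defensive.

Definition is_minimum (P : nat -> Prop) (m : nat) : Prop :=
  P m /\ forall k, P k -> m <= k.

Lemma is_minimum_unique (P : nat -> Prop) (m k : nat) :
  is_minimum P m -> is_minimum P k -> m = k.
Proof.
by move=> [Pm minm] [Pk mink]; apply/eqP; rewrite eqn_leq minm ?mink.
Qed.

Record sgraph (T : finType) := SGraph {
  adj :> rel T;
  adj_sym : symmetric adj;
  adj_irr : irreflexive adj }.

Section Graphs.
Variables (T : finType) (G : sgraph T).

Definition edges : {set {set T}} :=
  [set [set p.1; p.2] | p : T * T & adj G p.1 p.2].

(* The subgraph of G induced by A is connected. *)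
Definition connected_on (A : {set T}) : Prop :=
  {in A &, forall x y,
     connect [rel u v | [&& adj G u v, u \in A & v \in A]] x y}.

Definition two_connected : Prop :=
  2 < #|T| /\ forall X : {set T}, #|X| < 2 -> connected_on (~: X).

(* Only the values of c on the edges of G are relevant. *)
Definition colouring (r : nat) (c : {set T} -> nat) : Prop :=
  {in edges, forall e, 1 <= c e <= r}.

(* A path from x is given, as in the library, by the sequence p of the
   vertices following x; it is a path from x to y when last x p = y. *)
Definition path_between (x y : T) (p : seq T) : bool :=
  [&& path (adj G) x p, last x p == y & uniq (x :: p)].

Definition path_edges (x : T) (p : seq T) : seq {set T} :=
  pairmap (fun u v => [set u; v]) x p.

Definition inner_vertices (x : T) (p : seq T) : seq T :=
  behead (belast x p).

Definition rainbow (c : {set T} -> nat) (x : T) (p : seq T) : bool :=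
  uniq (map c (path_edges x p)).

(* The two paths must be distinct: an edge, as a path of length one, has no
   inner vertices and would otherwise be disjoint from itself. *)
Definition rainbow_2_connected (c : {set T} -> nat) : Prop :=
  forall x y : T, x != y ->
  exists p q : seq T,
    [/\ path_between x y p /\ rainbow c x p,
        path_between x y q /\ rainbow c x q,
        p != q
      & ~~ has (mem (inner_vertices x p)) (inner_vertices x q)].

(* k = rc_2(G) *)
Definition is_rc2 (k : nat) : Prop :=
  is_minimum
    (fun r => exists c, colouring r c /\ rainbow_2_connected c) k.

End Graphs.

(* m = t_2(n, r).  A relation rather than a function, so that no value has to
   be chosen when no such graph exists. *)
Definition is_t2 (n r m : nat) : Prop :=
  is_minimum
    (fun e => exists (T : finType) (G : sgraph T),
       [/\ #|T| = n, two_connected G, #|edges G| = e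
         & exists2 k, is_rc2 G k & k <= r]) m.

(* Main.v *)
(* The graphs consist of two hubs a and b, of a few vertices of degree 2 between
   them, and of arbitrarily many identically coloured copies of a piece attached
   to the hubs. For r = 3 the piece is an edge with both ends adjacent to both
   hubs (5 edges for 2 vertices); for r = 5 it is a triangle with four edges to
   the hubs (7 for 3); for r = 6 it is a 4-cycle with one edge from each vertex
   to a hub (8 for 4). As all copies look alike, it suffices to link two
   vertices inside the core and at most two copies, which is a finite check. For
   r > 6, one subdivides an edge at a vertex of degree 2 lying on a rainbow
   cycle: each subdivision costs one vertex, one edge and one colour. *)
Require Import Defs.
From mathcomp Require Import all_boot all_order all_algebra.
From mathcomp Require Import zify lra.
From Stdlib Require Import Classical.
Import Order.TTheory GRing.Theory Num.Theory.
Set Implicit Arguments.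
Unset Strict Implicit.
Unset Printing Implicit Defensive.

(** By strong induction on [k]: either [k] is minimal or a smaller value satisfies [P]. Excluded
    middle decides which, as [P] is an arbitrary proposition. *)
Lemma minimum_exists (P : nat -> Prop) (k : nat) :
  P k -> exists2 m, is_minimum P m & m <= k.
Proof.
have [n] := ubnP k; elim: n k => // n IHn k lt_kn Pk.
case: (classic (exists2 j, P j & j < k)) => [[j Pj lt_jk]|no_less].
  have [m minm le_mj] := IHn j (leq_trans lt_jk lt_kn) Pj.
  by exists m => //; apply: leq_trans le_mj (ltnW lt_jk).
exists k => //; split=> // j Pj; rewrite leqNgt; apply/negP => lt_jk.
by apply: no_less; exists j.
Qed.

(** * Rainbow paths and their images under embeddings *)

(* An edge-coloured graph is given by [col : V -> V -> nat], where [col x y = 0]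
   means that x and y are not adjacent. A path from x to y is given by the
   sequence of its inner vertices. *)
Section RainbowPaths.
Variables (V : eqType) (col : V -> V -> nat).

Definition edge : rel V := fun x y => col x y != 0.

Definition rainbow_path (x y : V) (m : seq V) : bool :=
  [&& path edge x (rcons m y), uniq (x :: rcons m y)
    & uniq (pairmap col x (rcons m y))].

(** Equal disjoint lists are both empty, so [m1 != m2] only excludes using the edge xy twice. *)
Definition linked (x y : V) (m1 m2 : seq V) : bool :=
  [&& rainbow_path x y m1, rainbow_path x y m2, m1 != m2
    & ~~ has (mem m1) m2].

Lemma linkedC x y m1 m2 : linked x y m1 m2 -> linked x y m2 m1.
Proof.
by case/and4P=> r1 r2 ne dj; rewrite /linked r1 r2 eq_sym ne has_sym.
Qed.

Hypothesis col_sym : forall x y, col x y = col y x.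

Lemma rainbow_path_rev x y m : rainbow_path x y m -> rainbow_path y x (rev m).
Proof.
have revE : rev (x :: rcons m y) = y :: rcons (rev m) x.
  by rewrite rev_cons rev_rcons.
case/and3P=> pm um cm; apply/and3P; split.
- rewrite -rev_cons -(belast_rcons x m y) -{1}(last_rcons x m y) rev_path.
  by rewrite (eq_path (e' := edge)) // => a b; rewrite /edge /= col_sym.
- by rewrite -revE rev_uniq.
have pairmap_rev z (s : seq V) :
    pairmap col (last z s) (rev (belast z s)) = rev (pairmap col z s).
  elim: s z => //= a s IHs z; rewrite !rev_cons -IHs.
  case: s {IHs} => [|b s] /=; first by rewrite col_sym.
  rewrite rev_cons -!cats1 pairmap_cat; congr cat.
  by rewrite cats1 last_rcons /= col_sym.
have := pairmap_rev x (rcons m y).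
by rewrite last_rcons belast_rcons rev_cons => ->; rewrite rev_uniq.
Qed.

Lemma linked_rev x y m1 m2 : linked x y m1 m2 -> linked y x (rev m1) (rev m2).
Proof.
case/and4P=> r1 r2 ne dj; rewrite /linked !rainbow_path_rev // has_rev.
rewrite (can_eq revK) ne /= (eq_has (a2 := mem m1)) // => z.
by rewrite /= mem_rev.
Qed.

End RainbowPaths.

(** Everything is relative to [L] because a template is embedded in its graph only on finitely many
    codes. *)
Lemma rainbow_path_map (V W : eqType) (colV : V -> V -> nat)
    (colW : W -> W -> nat) (f : V -> W) (L : seq V) (x y : V) (m : seq V) :
    {in L &, injective f} ->
    {in L &, forall a b, colW (f a) (f b) = colV a b} ->
    {subset x :: rcons m y <= L} ->
  rainbow_path colV x y m -> rainbow_path colW (f x) (f y) (map f m).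
Proof.
move=> injf colf sL /and3P[pm um cm]; rewrite /rainbow_path -map_rcons.
have [pE cE] : path (edge colW) (f x) (map f (rcons m y))
                 = path (edge colV) x (rcons m y)
            /\ pairmap colW (f x) (map f (rcons m y))
                 = pairmap colV x (rcons m y).
  elim: (rcons m y) x sL {pm um cm} => //= a s IHs x sL.
  have [|-> ->] := IHs a; first by move=> z zs; apply: sL; rewrite inE zs orbT.
  by rewrite /edge colf // sL // !inE eqxx ?orbT.
rewrite pE cE pm cm andbT -map_cons map_inj_in_uniq //.
by move=> a b /sL aL /sL bL; apply: injf.
Qed.

Lemma linked_map (V W : eqType) (colV : V -> V -> nat)
    (colW : W -> W -> nat) (f : V -> W) (L : seq V) (x y : V)
    (m1 m2 : seq V) :
    {in L &, injective f} ->
    {in L &, forall a b, colW (f a) (f b) = colV a b} ->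
    x \in L -> y \in L -> {subset m1 <= L} -> {subset m2 <= L} ->
  linked colV x y m1 m2 -> linked colW (f x) (f y) (map f m1) (map f m2).
Proof.
move=> injf colf xL yL s1 s2 /and4P[r1 r2 ne dj].
have sub m : {subset m <= L} -> {subset x :: rcons m y <= L}.
  by move=> s z; rewrite inE mem_rcons inE => /or3P[/eqP->|/eqP->|/s].
have map_neq (s t : seq V) : {subset s <= L} -> {subset t <= L} ->
    map f s = map f t -> s = t.
  elim: s t => [|a s IHs] [|b t] //= sL tL [eq_ab eq_st].
  rewrite (IHs t) //; first congr (_ :: _).
  - by apply: injf => //; [apply: sL | apply: tL]; rewrite mem_head.
  - by move=> z zs; apply: sL; rewrite inE zs orbT.
  by move=> z zs; apply: tL; rewrite inE zs orbT.
apply/and4P; split.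
- exact: (rainbow_path_map injf colf (sub _ s1) r1).
- exact: (rainbow_path_map injf colf (sub _ s2) r2).
- by apply: contra ne => /eqP /map_neq ->.
apply: contra dj => /hasP[z /mapP[b b2 ->] /mapP[a a1 eq_ba]].
apply/hasP; exists b => //=; rewrite (injf b a) //; first exact: s2.
exact: s1.
Qed.

(** * From coloured graphs to bounds on [t_2] *)

(** Both [r] and [e] are upper bounds. A list holding every edge in some orientation is easier to
    carry through constructions than a set of unordered pairs. *)
Record rainbow_graph (r e : nat) (T : finType) (col : T -> T -> nat) : Prop :=
  RainbowGraph {
    rg_sym : forall x y, col x y = col y x;
    rg_irr : forall x, col x x = 0;
    rg_le : forall x y, col x y <= r;
    rg_linked : forall x y, x != y -> exists m1 m2, linked col x y m1 m2;
    rg_edges : exists2 es : seq (T * T), size es <= e &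
      forall x y, edge col x y -> ((x, y) \in es) || ((y, x) \in es) }.

Section ToSgraph.
Variables (T : finType) (col : T -> T -> nat).
Hypotheses (col_sym : forall x y, col x y = col y x)
           (col_irr : forall x, col x x = 0).

Lemma edge_sym : symmetric (edge col).
Proof. by move=> x y; rewrite /edge col_sym. Qed.

Lemma edge_irr : irreflexive (edge col).
Proof. by move=> x; rewrite /edge col_irr. Qed.

Definition col_graph : sgraph T := SGraph edge_sym edge_irr.

Definition set_col (A : {set T}) : nat :=
  if [pick p : T * T | A == [set p.1; p.2]] is Some p then col p.1 p.2 else 0.

(** An unordered pair determines its ends up to order, and [col] is symmetric, so the choice made by
    [pick] is immaterial. *)
Lemma set_colE x y : set_col [set x; y] = col x y.
Proof.
rewrite /set_col; case: pickP => [[a b] /= /eqP eqA|/(_ (x, y))]; last first.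
  by rewrite /= eqxx.
have: a \in [set x; y] by rewrite eqA set21.
have: b \in [set x; y] by rewrite eqA set22.
have: x \in [set a; b] by rewrite -eqA set21.
have: y \in [set a; b] by rewrite -eqA set22.
rewrite !inE => y_ab x_ab /pred2P[]eq_b /pred2P[]eq_a; subst=> //.
  by move: y_ab; rewrite orbb => /eqP->.
by move: x_ab; rewrite orbb => /eqP->.
Qed.

Lemma rainbow_path_between x y m : rainbow_path col x y m ->
  path_between col_graph x y (rcons m y) /\ rainbow set_col x (rcons m y).
Proof.
case/and3P=> pm um cm; split.
  by apply/and3P; split; rewrite ?last_rcons.
rewrite /rainbow /path_edges.
suff -> s z : map set_col (pairmap (fun u v => [set u; v]) z s)
                = pairmap col z s by [].
by elim: s z => //= a s IHs z; rewrite set_colE IHs.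
Qed.

End ToSgraph.

(** A single deleted vertex lies inside at most one of two internally disjoint paths; the other path
    survives. *)
Lemma rainbow_2_connectedW (T : finType) (G : sgraph T) (c : {set T} -> nat) :
  2 < #|T| -> rainbow_2_connected G c -> two_connected G.
Proof.
move=> T2 rcG; split=> // X X1 x y; rewrite !inE => xX yX.
have [<-|ne] := eqVneq x y; first exact: connect0.
have [p [q [[pp _] [qq _] _ dj]]] := rcG x y ne.
have avoid s : path_between G x y s -> {subset inner_vertices x s <= ~: X} ->
    connect [rel u v | [&& adj G u v, u \in ~: X & v \in ~: X]] x y.
  case/and3P=> ps /eqP ls us sX; apply/connectP; exists s => //.
  have {sX} sX : {subset x :: s <= ~: X}.
    case: s ps ls us sX => [|a s] /= _ ls _ sX z.
      by rewrite inE => /eqP->; rewrite inE.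
    rewrite inE => /predU1P[->|]; first by rewrite inE.
    rewrite lastI mem_rcons inE => /predU1P[->|/sX//].
    by rewrite ls inE.
  elim: s x {ls us xX ne rcG pp qq dj} ps sX => //= a s IHs x.
  case/andP=> xa ps sX; rewrite xa !sX ?inE ?eqxx ?orbT //=.
  by apply: IHs => // z zs; apply: sX; rewrite inE zs orbT.
have [pX|/subsetPn[z zp]] :=
    boolP ([set z in inner_vertices x p] \subset ~: X).
  by apply: avoid pp _ => z zp; apply: (subsetP pX); rewrite inE.
rewrite inE in zp; rewrite inE negbK => zX.
apply: avoid qq _ => t tq; rewrite inE.
apply/negP => tX.
have eqzt : z = t by apply: (card_le1_eqP (X1 : #|X| <= 1)).
by case/negP: dj; apply/hasP; exists t => //; rewrite -eqzt.
Qed.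

(** The graph itself competes in the minimum: its colouring bounds [rc_2] by [r], and the list [es]
    bounds its number of edges by [e]. *)
Lemma rainbow_graph_t2 (r e : nat) (T : finType) (col : T -> T -> nat) :
  2 < #|T| -> rainbow_graph r e col ->
  exists2 t, is_t2 #|T| r t & t <= e.
Proof.
move=> T2 [cs ci cr lk [es es_e cov]].
pose G := col_graph cs ci.
have rc2 : rainbow_2_connected G (set_col col).
  move=> x y /lk[m1 [m2 /and4P[r1 r2 ne dj]]].
  exists (rcons m1 y), (rcons m2 y); split.
  - exact: rainbow_path_between r1.
  - exact: rainbow_path_between r2.
  - by apply: contra ne => /eqP /rcons_inj[->].
  by rewrite /inner_vertices !belast_rcons.
have [k rck kr] : exists2 k, is_rc2 G k & k <= r.
  apply: minimum_exists; exists (set_col col); split=> // A.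
  case/imsetP=> -[a b]; rewrite inE => ab ->.
  by rewrite set_colE // cr andbT lt0n.
have [|t tmin te] := @minimum_exists (fun e => exists (T' : finType)
    (G' : sgraph T'), [/\ #|T'| = #|T|, two_connected G', #|edges G'| = e
      & exists2 k, is_rc2 G' k & k <= r]) #|edges G|.
  exists T, G; split=> //; first exact: rainbow_2_connectedW rc2.
  by exists k.
exists t => //; apply: leq_trans te (leq_trans _ es_e).
apply: (@leq_trans #|[set [set p.1; p.2] | p in es]|).
  apply/subset_leq_card/subsetP => A /imsetP[[a b]]; rewrite inE => ab ->.
  case/orP: (cov a b ab) => [es_ab|es_ba].
    by apply/imsetP; exists (a, b).
  by apply/imsetP; exists (b, a) => //=; rewrite setUC.
by apply: leq_trans (leq_imset_card _ _) (card_size _).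
Qed.

(** * Graphs built from templates *)

(* A template lists the coloured edges (a, b, colour) of a graph in which the
   labels 0, ..., p span a piece and the labels p + 1, ..., p + c + 1 a core.
   The template graph consists of one copy of the core and of m + 1 copies of
   the piece; the vertex with label l of the k-th copy is encoded as (k, l),
   where k = 0 for the core. Edges at labels larger than p + c + 1 are dropped,
   so that one list serves several core sizes. *)
Definition template := seq (nat * nat * nat).

Definition lcol (E : template) (a b : nat) : nat :=
  head 0 [seq e.2 | e <- E & (e.1 == (a, b)) || (e.1 == (b, a))].

(** Different copies of the piece meet only through the core, which is copy 0. *)
Definition ccol (E : template) (x y : nat * nat) : nat :=
  if [|| x.1 == 0, y.1 == 0 | x.1 == y.1] then lcol E x.2 y.2 else 0.

Definition core_codes (p c : nat) : seq (nat * nat) :=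
  [seq (0, l) | l <- iota p.+1 c.+1].

Definition piece_codes (p k : nat) : seq (nat * nat) :=
  [seq (k, l) | l <- iota 0 p.+1].

(** The cycle is rotated to start at [x] and cut at [y]; the second arc is read backwards. As
    [linked] verifies the outcome, an unsuitable cycle can only fail the check. *)
Definition cycle_linked (col : nat * nat -> nat * nat -> nat)
    (x y : nat * nat) (s : seq (nat * nat)) : bool :=
  let s' := behead (rot (index x s) s) in
  linked col x y (take (index y s') s') (rev (drop (index y s').+1 s')).

Definition covered (E : template) (cs : seq (seq (nat * nat)))
    (L : seq (nat * nat)) (x y : nat * nat) : bool :=
  (x != y) ==> has (fun s => all (mem L) s && cycle_linked (ccol E) x y s) cs.

(** The second condition allows a single copy of the piece, so that it applies even when the graph
    has only one; the third lets vertices of two copies use both. *)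
Definition template_ok (r p c : nat) (E : template)
    (cs : seq (seq (nat * nat))) : bool :=
  let L := core_codes p c ++ piece_codes p 1 in
  [&& all (fun e => (e.1.1 != e.1.2) && (e.2 <= r)) E,
      all (fun x => all (covered E cs L x) L) L
    & all (fun x => all (covered E cs (L ++ piece_codes p 2) x)
                        (piece_codes p 2)) (piece_codes p 1)].

Definition core_edges (p c : nat) (E : template) : template :=
  [seq e <- E | [&& p < e.1.1 < p + c.+2 & p < e.1.2 < p + c.+2]].

Definition piece_edges (p : nat) (E : template) : template :=
  [seq e <- E | (e.1.1 <= p) || (e.1.2 <= p)].

Lemma lcol_sym E a b : lcol E a b = lcol E b a.
Proof. by congr (head _ (map _ _)); apply: eq_filter => e; rewrite orbC. Qed.

Lemma lcol_neq0 E a b : lcol E a b != 0 ->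
  exists2 e, e \in E & (e.1 == (a, b)) || (e.1 == (b, a)).
Proof.
rewrite /lcol; set F := [seq e <- E | _].
have: {subset F <= [seq e <- E | (e.1 == (a, b)) || (e.1 == (b, a))]} by [].
case: F => [|e F] //= /(_ e (mem_head _ _)); rewrite mem_filter.
by case/andP=> eab eE _; exists e.
Qed.

Lemma ccol_sym E x y : ccol E x y = ccol E y x.
Proof.
by rewrite /ccol lcol_sym orbCA [x.1 == y.1]eq_sym.
Qed.

Section TemplateGraph.
Variables (r m p c : nat) (E : template) (cs : seq (seq (nat * nat))).

Definition tvertex : finType := ('I_m.+1 * 'I_p.+1 + 'I_c.+1)%type.

(** Copies are numbered from 0 in ['I_m.+1] but from 1 in codes, where 0 stands for the core. *)
Definition code (v : tvertex) : nat * nat :=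
  match v with inl (k, l) => (k.+1, l : nat) | inr l => (0, p.+1 + l) end.

Definition vertex (k : 'I_m.+1) (l : nat) : tvertex :=
  if l <= p then inl (k, inord l) else inr (inord (l - p.+1)).

Definition tcol (u v : tvertex) : nat := ccol E (code u) (code v).

Lemma vertexK (k : 'I_m.+1) v :
  (code v).1 \in [:: 0; k.+1] -> vertex k (code v).2 = v.
Proof.
case: v => [[k' l]|l] /=.
  rewrite !inE /= eqSS => /eqP eq_k; rewrite /vertex -ltnS ltn_ord inord_val.
  by congr (inl (_, _)); apply: val_inj.
by rewrite /vertex leqNgt ltnS leq_addr /= addKn inord_val.
Qed.

Lemma code_vertex k l : l < p + c.+2 ->
  code (vertex k l) = (if l <= p then k.+1 else 0, l).
Proof.
move=> ub; rewrite /vertex; case: leqP => /= pl; first by rewrite inordK.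
by rewrite inordK; [rewrite subnKC | lia].
Qed.

Lemma card_tvertex : #|tvertex| = m.+1 * p.+1 + c.+1.
Proof. by rewrite card_sum card_prod !card_ord. Qed.

(** Copies 1 and 2 of the finite check are realised by [k1] and [k2]. For core codes the copy is
    irrelevant, since their labels exceed [p]. *)
Definition place (k1 k2 : 'I_m.+1) (x : nat * nat) : tvertex :=
  vertex (if x.1 == 2 then k2 else k1) x.2.

Hypothesis ok : template_ok r p c E cs.

Let L1 := core_codes p c ++ piece_codes p 1.
Let L2 := L1 ++ piece_codes p 2.

Lemma mem_L1 x : (x \in L1) = [|| (x.1 == 0) && (p < x.2 < p + c.+2)
                                | (x.1 == 1) && (x.2 <= p)].
Proof.
have memc k i n : (x \in [seq (k, l) | l <- iota i n])
    = (x.1 == k) && (i <= x.2 < i + n).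
  apply/mapP/andP => [[l] + ->|[/eqP<-]]; first by rewrite mem_iota.
  by exists x.2; [rewrite mem_iota | apply: surjective_pairing].
by rewrite mem_cat !memc add0n ltnS /= addSnnS.
Qed.

Lemma mem_L2 x : (x \in L2) = (x \in L1) || (x.1 == 2) && (x.2 <= p).
Proof.
rewrite mem_cat; congr (_ || _).
apply/mapP/andP => [[l] + ->|[/eqP<-]]; first by rewrite mem_iota.
by exists x.2; [rewrite mem_iota | apply: surjective_pairing].
Qed.

(** Placing a code only renames its copy, by [ren], which is injective on the copies that occur in
    [L]. Colours survive because [ccol] merely compares copy numbers with 0 and with each other. *)
Lemma place_embedding (L : seq (nat * nat)) k1 k2 :
    {subset L <= L2} -> (k1 != k2) || all (fun z => z.1 != 2) L ->
  {in L &, injective (place k1 k2)} /\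
  {in L &, forall x y, tcol (place k1 k2 x) (place k1 k2 y) = ccol E x y}.
Proof.
move=> sL k12.
pose ren i : nat := if i == 0 then 0 else if i == 2 then k2.+1 else k1.+1.
have codeE z : z \in L -> code (place k1 k2 z) = (ren z.1, z.2).
  case: z => i l /sL; rewrite mem_L2 mem_L1 /place /= => zL.
  rewrite code_vertex; last by lia.
  rewrite /ren; congr (_, _).
  by case: i zL => [|[|[|?]]] //=; case: leqP => //; lia.
have renE : {in L &, forall z t, (ren z.1 == ren t.1) = (z.1 == t.1)}.
  move=> z t zL tL.
  have neq2 u : u \in L -> u.1 = 2 -> k1 != k2.
    by move=> uL u2; case/orP: k12 => // /allP/(_ u uL); rewrite u2.
  have := neq2 z zL; have := neq2 t tL.
  move/sL: zL; move/sL: tL; rewrite !mem_L2 !mem_L1 /ren -!(inj_eq val_inj) /=.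
  by case: z t => [[|[|[|?]]] ?] [[|[|[|?]]] ?] //=; lia.
split=> z t zL tL.
  move=> /(congr1 code); rewrite !codeE // => -[/eqP + eq2].
  rewrite renE // => /eqP eq1; move: eq1 eq2.
  by case: z t {zL tL} => [? ?] [? ?] /= -> ->.
have ren0 i : (ren i == 0) = (i == 0).
  by rewrite /ren; case: (i =P 0) => // _; case: ifP.
by rewrite /tcol /ccol !codeE //= renE // !ren0.
Qed.

Lemma place_linked (L : seq (nat * nat)) k1 k2 x y :
    {subset L <= L2} -> (k1 != k2) || all (fun z => z.1 != 2) L ->
    x \in L -> y \in L -> x != y -> covered E cs L x y ->
  exists m1 m2, linked tcol (place k1 k2 x) (place k1 k2 y) m1 m2.
Proof.
move=> sL k12 xL yL ne; rewrite /covered ne /= => /hasP[s _ /andP[/allP sS]].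
have [inj col_eq] := place_embedding sL k12.
have subs t : {subset t <= behead (rot (index x s) s)} -> {subset t <= L}.
  by move=> ts z /ts/mem_behead; rewrite mem_rot => /sS.
move/(linked_map inj col_eq xL yL) => link.
do 2!eexists; apply: link; apply: subs => z; first exact: mem_take.
by rewrite mem_rev; apply: mem_drop.
Qed.

(** Either one copy and the core contain both vertices, and that copy plays copy 1 of the check, or
    the vertices lie in two copies, which play copies 1 and 2. *)
Lemma tcol_linked u v : u != v -> exists m1 m2, linked tcol u v m1 m2.
Proof.
case/and3P: ok => _ /allP ok1 /allP ok2 ne.
have L12 : {subset L1 <= L2} by move=> x; rewrite mem_L2 => ->.
have L1no2 : all (fun z => z.1 != 2) L1.
  by apply/allP => -[a l]; rewrite mem_L1 /=; lia.
pose kind (w : tvertex) : nat := if w is inl _ then 1 else 0.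
pose copy (w : tvertex) : 'I_m.+1 := if w is inl (k, _) then k else ord0.
have codeL1 w : (kind w, (code w).2) \in L1.
  rewrite mem_L1; case: w => [[k l]|l] /=.
    by rewrite -ltnS ltn_ord.
  by have := ltn_ord l; lia.
have placeK k1 k2 w : kind w = 0 \/ copy w = k1 ->
    place k1 k2 (kind w, (code w).2) = w.
  move=> kw; rewrite /place /=.
  have -> : (kind w == 2) = false by case: (w).
  apply: vertexK; rewrite !inE; case: w kw => [[k l]|l] //=.
  by case=> // ->; rewrite eqxx.
have one_copy k : kind u = 0 \/ copy u = k -> kind v = 0 \/ copy v = k ->
    exists m1 m2, linked tcol u v m1 m2.
  move=> uk vk; rewrite -(placeK k k u) // -(placeK k k v) //.
  apply: (@place_linked L1) => //; first by rewrite L1no2 orbT.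
    by apply: contra ne => /eqP/(congr1 (place k k)); rewrite !placeK // => ->.
  by have /allP := ok1 _ (codeL1 u); apply.
case: u v ne one_copy => [[k1 l1]|l1] [[k2 l2]|l2] ne one_copy.
- have [eqk|neqk] := eqVneq k1 k2; first by apply: (one_copy k1); right.
  have -> : inl (k1, l1) = place k1 k2 (1, l1 : nat).
    by rewrite -[LHS](@vertexK k1) //= !inE eqxx orbT.
  have -> : inl (k2, l2) = place k1 k2 (2, l2 : nat).
    by rewrite -[LHS](@vertexK k2) //= !inE eqxx orbT.
  have l1p : (1, l1 : nat) \in piece_codes p 1.
    by rewrite map_f // mem_iota add0n ltn_ord.
  have l2p : (2, l2 : nat) \in piece_codes p 2.
    by rewrite map_f // mem_iota add0n ltn_ord.
  apply: (@place_linked L2) => //; first by rewrite neqk.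
  - by rewrite mem_L2 mem_L1 /= -ltnS ltn_ord.
  - by rewrite mem_L2 /= -ltnS ltn_ord orbT.
  by have /allP := ok2 _ l1p; apply.
- by apply: (one_copy k1); [right | left].
- by apply: (one_copy k2); [left | right].
by apply: (one_copy ord0); left.
Qed.

Lemma template_rainbow_graph :
  rainbow_graph r (size (core_edges p c E) + m.+1 * size (piece_edges p E))
    tcol.
Proof.
case/and3P: (ok) => /allP okE _ _; split.
- by move=> u v; apply: ccol_sym.
- move=> u; rewrite /tcol /ccol; case: ifP => // _; apply/eqP/negPn/negP.
  by case/lcol_neq0=> -[[a b] k] /okE/andP[/= ne _] /orP[]/eqP[]; lia.
- move=> u v; rewrite /tcol /ccol; case: ifP => // _; rewrite /lcol.
  have: {subset [seq e <- E | (e.1 == ((code u).2, (code v).2))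
                || (e.1 == ((code v).2, (code u).2))] <= E}.
    by move=> e; rewrite mem_filter => /andP[].
  by case: filter => [|e F] //= /(_ e (mem_head _ _))/okE/andP[].
- exact: tcol_linked.
pose ends k (e : nat * nat * nat) := (vertex k e.1.1, vertex k e.1.2).
exists (map (ends ord0) (core_edges p c E)
        ++ [seq ends k e | k <- enum 'I_m.+1, e <- piece_edges p E]).
  by rewrite size_cat size_map size_allpairs -cardE card_ord.
move=> u v; rewrite /edge /tcol /ccol; case: ifP => // compat.
case/lcol_neq0=> e eE ends_e.
(* The edge is listed under the copy that contains one of its ends; an edge inside the core is
   listed once, under [ord0]. *)
have [k [ku kv k0]] : exists k : 'I_m.+1,
    [/\ (code u).1 \in [:: 0; k.+1], (code v).1 \in [:: 0; k.+1]
      & (code u).1 = 0 -> (code v).1 = 0 -> k = ord0].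
  case: u v compat {ends_e} => [[k1 l1]|l1] [[k2 l2]|l2] /= compat.
  - by exists k1; rewrite !inE /= eqxx eq_sym; split.
  - by exists k1; rewrite !inE !eqxx ?orbT.
  - by exists k2; rewrite !inE !eqxx ?orbT; split.
  by exists ord0.
suff: (ends k e \in map (ends ord0) (core_edges p c E)
        ++ [seq ends k e | k <- enum 'I_m.+1, e <- piece_edges p E]).
  rewrite /ends; case/orP: ends_e => /eqP-> /=; rewrite !vertexK // => -> //.
  by rewrite orbT.
rewrite mem_cat; have [piece_e|] := boolP ((e.1.1 <= p) || (e.1.2 <= p)).
  apply/orP; right; apply/allpairsP; exists (k, e).
  by rewrite mem_enum mem_filter piece_e.
rewrite negb_or -!ltnNge => /andP[p1 p2].
have bound w : p < (code w).2 -> (code w).1 = 0 /\ (code w).2 < p + c.+2.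
  case: w => [[k' l]|l] /=; first by rewrite ltnNge -ltnS ltn_ord.
  by have := ltn_ord l; lia.
have [bu bv] : p < (code u).2 /\ p < (code v).2.
  by case/orP: ends_e p1 p2 => /eqP-> /=.
have [[u0 ub] [v0 vb]] := (bound u bu, bound v bv).
rewrite (k0 u0 v0) map_f // mem_filter eE p1 p2 andbT /=.
by case/orP: ends_e => /eqP-> /=; rewrite ub vb.
Qed.

End TemplateGraph.

(** * The three templates *)

Definition decode_cycles : seq (seq nat) -> seq (seq (nat * nat)) :=
  map (map (fun n => (n %/ 10, n %% 10))).

(* Each vertex of the cycles below is given by the number 10 k + l, for the
   vertex with label l of the k-th copy. The colours and the cycles come from a
   computer search; the cycles are such that any two vertices split one of them
   into two rainbow paths. *)

(* Hubs 2 and 3, adjacent to both vertices of the piece; 4 has degree 2. *)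
Definition template3 : template :=
  [:: (0, 1, 3); (0, 2, 1); (1, 2, 2); (0, 3, 2); (1, 3, 1);
      (2, 4, 3); (4, 3, 3)].

Definition cycles3 : seq (seq (nat * nat)) := decode_cycles
  [:: [:: 2; 4; 3; 11]; [:: 2; 10; 11]; [:: 2; 11; 10; 3; 21; 20];
      [:: 3; 10; 11]; [:: 2; 11; 3; 20]; [:: 2; 4; 3; 10];
      [:: 2; 10; 3; 11]; [:: 2; 10; 3; 21]].

(* Hubs 3 and 4, joined by the path 3, 5, 6, 4; 7 and 8 have degree 2. *)
Definition template5 : template :=
  [:: (0, 1, 4); (1, 2, 4); (2, 0, 5); (0, 3, 2); (1, 3, 1); (2, 4, 3);
      (1, 4, 2); (3, 5, 4); (5, 6, 3); (6, 4, 5); (3, 7, 2); (7, 4, 2);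
      (3, 8, 1); (8, 4, 1)].

Definition cycles5 : seq (seq (nat * nat)) := decode_cycles
  [:: [:: 3; 5; 6; 4; 11]; [:: 3; 7; 4; 12; 10; 11]; [:: 4; 11; 10; 12];
      [:: 3; 5; 6; 4; 8]; [:: 3; 11; 12; 4; 21; 22; 20];
      [:: 3; 8; 4; 11; 12; 10]; [:: 3; 10; 12; 11]; [:: 3; 5; 6; 4; 7];
      [:: 3; 11; 4; 22; 20]; [:: 3; 5; 6; 4; 11; 12; 10];
      [:: 3; 10; 12; 4; 21]; [:: 3; 5; 6; 4; 11; 10];
      [:: 3; 10; 11; 4; 22; 20; 21]; [:: 3; 7; 4; 8]].

(* Hubs 4 and 5; 6, 7, 8 and 9 have degree 2, and the piece is a 4-cycle. *)
Definition template6 : template :=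
  [:: (0, 1, 3); (1, 2, 2); (2, 3, 3); (3, 0, 5); (0, 4, 1); (1, 4, 6);
      (2, 5, 4); (3, 5, 6); (4, 6, 5); (6, 5, 3); (4, 7, 4); (7, 5, 2);
      (4, 8, 6); (8, 5, 1); (4, 9, 3); (9, 5, 4)].

Definition cycles6 : seq (seq (nat * nat)) := decode_cycles
  [:: [:: 4; 6; 5; 12; 11]; [:: 5; 12; 11; 10; 13];
      [:: 4; 10; 11; 12; 5; 23; 20; 21]; [:: 4; 8; 5; 12; 11; 10];
      [:: 4; 7; 5; 12; 13; 10]; [:: 4; 11; 12; 13; 5; 22; 23; 20];
      [:: 4; 11; 12; 5; 23; 20]; [:: 4; 10; 13; 5; 22; 21];
      [:: 4; 9; 5; 13; 10]; [:: 4; 6; 5; 8]; [:: 4; 6; 5; 13; 10; 11];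
      [:: 4; 9; 5; 13; 12; 11]; [:: 4; 6; 5; 7]; [:: 4; 10; 13; 12; 11];
      [:: 4; 7; 5; 8]; [:: 4; 6; 5; 13; 12; 11]; [:: 4; 7; 5; 9];
      [:: 4; 6; 5; 9]; [:: 4; 7; 5; 13; 10; 11]; [:: 4; 8; 5; 9];
      [:: 4; 8; 5; 12; 13; 10]].

(** Each template is checked by computation for [p + 1] consecutive core sizes, so that all residues
    of the number of vertices modulo the piece size are reached. *)
Lemma template3_ok c : 0 < c < 3 -> template_ok 3 1 c template3 cycles3.
Proof. by case: c => [|[|[|c]]] // _; vm_compute. Qed.

Lemma template5_ok c : 2 < c < 6 -> template_ok 5 2 c template5 cycles5.
Proof. by case: c => [|[|[|[|[|[|c]]]]]] // _; vm_compute. Qed.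

Lemma template6_ok c : 1 < c < 6 -> template_ok 6 3 c template6 cycles6.
Proof. by case: c => [|[|[|[|[|[|c]]]]]] // _; vm_compute. Qed.

(** Each of the [c - 1] core vertices other than the hubs accounts for two edges; in [template5] the
    labels 5 and 6 share one. *)
Lemma size_template3 c : 0 < c < 3 ->
  size (core_edges 1 c template3) = 2 * c - 2.
Proof. by case: c => [|[|[|c]]]. Qed.

Lemma size_template5 c : 2 < c < 6 ->
  size (core_edges 2 c template5) = 2 * c - 3.
Proof. by case: c => [|[|[|[|[|[|c]]]]]]. Qed.

Lemma size_template6 c : 1 < c < 6 ->
  size (core_edges 3 c template6) = 2 * c - 2.
Proof. by case: c => [|[|[|[|[|[|c]]]]]]. Qed.

(** * Subdividing an edge *)

(** The invariant of repeated subdivision: [u] has no neighbours besides [v] and [w], and the edge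
    uv closes the path through [m] to a rainbow cycle. *)
Definition subdividable (n r e : nat) : Prop :=
  exists (T : finType) (col : T -> T -> nat),
    [/\ #|T| = n, rainbow_graph r e col &
      exists u v w m,
        [/\ edge col u v, forall x, edge col u x -> x = v \/ x = w,
            rainbow_path col v u m & col u v \notin pairmap col v (rcons m u)]].

Section Subdivision.
Variables (T : finType) (col : T -> T -> nat) (r e : nat) (u v w : T).
Hypotheses (rg : rainbow_graph r e col) (uv : edge col u v).
Hypothesis deg_u : forall x, edge col u x -> x = v \/ x = w.

Definition on_uv (x y : T) : bool :=
  (x == u) && (y == v) || (x == v) && (y == u).

(* The new vertex is [None]. Its edge to v inherits the colour of uv, so that
   a path leaving u through its other neighbour w, extended to start at the new
   vertex, only gains the new colour r + 1. *)
Definition sub_col (x y : option T) : nat :=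
  match x, y with
  | Some x, Some y => if on_uv x y then 0 else col x y
  | None, Some y => if y == u then r.+1 else if y == v then col u v else 0
  | Some x, None => if x == u then r.+1 else if x == v then col u v else 0
  | None, None => 0
  end.

Fixpoint sub_path (x : T) (m : seq T) (y : T) : seq (option T) :=
  let step a b := if on_uv a b then [:: None] else [::] in
  if m is z :: m' then step x z ++ Some z :: sub_path z m' y else step x y.

Let neq_vu : (v == u) = false.
Proof.
by apply/eqP => eq_vu; move: uv; rewrite eq_vu /edge (rg_irr rg).
Qed.

Let neq_uv : (u == v) = false.
Proof. by rewrite eq_sym neq_vu. Qed.

Lemma on_uvC x y : on_uv x y = on_uv y x.
Proof. by rewrite /on_uv orbC andbC [(x == u) && _]andbC. Qed.

Lemma on_uv_col x y : on_uv x y -> col x y = col u v.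
Proof.
by case/orP=> /andP[/eqP-> /eqP->]; last exact: rg_sym rg _ _.
Qed.

Lemma pairmap_col_le a s z : z \in pairmap col a s -> z <= r.
Proof.
elim: s a => //= b s IHs a; rewrite inE => /predU1P[->|/IHs//].
exact: rg_le rg _ _.
Qed.

Lemma sub_col_sym x y : sub_col x y = sub_col y x.
Proof.
by case: x y => [x|] [y|] //=; rewrite on_uvC (rg_sym rg).
Qed.

Lemma sub_col_le x y : sub_col x y <= r.+1.
Proof.
have leS a b : col a b <= r.+1 by apply: leqW; apply: rg_le rg _ _.
by case: x y => [x|] [y|] //=; do ?case: ifP.
Qed.

Lemma mem_sub_path x m y z : (Some z \in sub_path x m y) = (z \in m).
Proof.
elim: m x => [|a m IHm] x /=; first by case: ifP; rewrite ?inE.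
rewrite mem_cat !inE IHm /=; case: ifP; rewrite ?inE //.
Qed.

Lemma None_sub_path x m y : None \in sub_path x m y ->
  [/\ u \in x :: rcons m y, v \in x :: rcons m y
    & col u v \in pairmap col x (rcons m y)].
Proof.
have step a b s : on_uv a b ->
    [/\ u \in a :: b :: s, v \in a :: b :: s
      & col u v \in pairmap col a (b :: s)].
  move=> ab; rewrite /= -(on_uv_col ab) mem_head.
  by case/orP: ab => /andP[/eqP-> /eqP->]; rewrite !inE !eqxx ?orbT.
elim: m x => [|a m IHm] x /=.
  by case: ifP => // xy _; apply: step.
rewrite mem_cat; case: ifP => [xa _|_ /=]; first exact: step.
rewrite inE /= => /IHm[uI vI cI].
by split; rewrite inE ?uI ?vI ?cI orbT.
Qed.

Lemma sub_path_edges x m y : path (edge col) x (rcons m y) ->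
  path (edge sub_col) (Some x) (rcons (sub_path x m y) (Some y)).
Proof.
have step a b s : edge col a b -> path (edge sub_col) (Some b) s ->
    path (edge sub_col) (Some a)
      ((if on_uv a b then [:: None] else [::]) ++ Some b :: s).
  move=> ab bs; case: ifP => [|nuv] /=; last by rewrite bs /edge /= nuv andbT.
  rewrite bs /edge /=.
  by case/orP=> /andP[/eqP-> /eqP->]; rewrite !eqxx ?neq_vu /= ?andbT //;
     exact: uv.
elim: m x => [|a m IHm] x /=; rewrite andbC => /andP[].
  by move=> _ xy; rewrite -cats1; apply: step.
by move=> /IHm am xa; rewrite rcons_cat; apply: step.
Qed.

(** A path runs along uv at most once; there the colour of uv is replaced by itself together with
    the new colour [r.+1]. *)
Lemma sub_path_colours x m y :
    uniq (x :: rcons m y) -> uniq (pairmap col x (rcons m y)) ->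
  let cs := pairmap sub_col (Some x) (rcons (sub_path x m y) (Some y)) in
  uniq cs /\ {subset cs <= r.+1 :: pairmap col x (rcons m y)}.
Proof.
(* For the induction one must also know that [r.+1] occurs only if the path visits [None]. *)
suff main : uniq (x :: rcons m y) -> uniq (pairmap col x (rcons m y)) ->
    let cs := pairmap sub_col (Some x) (rcons (sub_path x m y) (Some y)) in
    uniq cs /\ {in cs, forall z, z \in pairmap col x (rcons m y)
                  \/ z = r.+1 /\ None \in rcons (sub_path x m y) (Some y)}.
  move=> um cm; have [ucs scs] := main um cm; split=> // z /scs.
  by rewrite inE => -[->|[-> _]]; rewrite ?eqxx ?orbT.
have lt_uv : (r.+1 == col u v) = false by apply/eqP; have := rg_le rg u v; lia.
have swap a b s : on_uv a b ->
    perm_eq (pairmap sub_col (Some a) [:: None, Some b & s])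
      [:: r.+1, col u v & pairmap sub_col (Some b) s].
  case/orP=> /andP[/eqP-> /eqP->]; rewrite /= !eqxx neq_vu //.
  by rewrite (perm_catCA [:: col u v] [:: r.+1]).
have step a b (s : seq (option T)) (cs : seq nat) :
    col a b \notin cs -> (forall z, z \in cs -> z <= r) ->
    (on_uv a b -> None \notin s) ->
    let cs' := pairmap sub_col (Some b) s in
    uniq cs' ->
    {in cs', forall z, z \in cs \/ z = r.+1 /\ None \in s} ->
    let t := (if on_uv a b then [:: None] else [::]) ++ Some b :: s in
    let cs'' := pairmap sub_col (Some a) t in
    uniq cs'' /\
    {in cs'', forall z, z \in col a b :: cs \/ z = r.+1 /\ None \in t}.
  move=> ab le_cs noN cs' ucs' scs'; case: ifP => [on_ab|off_ab] t cs''.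
    have sub : {subset cs' <= cs}.
      by move=> z /scs'[//|[_]]; rewrite (negPf (noN on_ab)).
    have pcs := swap a b s on_ab; split.
      rewrite (perm_uniq pcs) /= inE lt_uv ucs' andbT /=.
      rewrite -(on_uv_col on_ab) (contra (@sub _) ab) andbT.
      by apply/negP => /sub/le_cs; rewrite ltnn.
    move=> z; rewrite (perm_mem pcs) !inE -(on_uv_col on_ab).
    case/or3P=> [/eqP->|->|/sub->]; [by right | by left |].
    by left; rewrite orbT.
  rewrite /cs'' /t /= off_ab ucs' andbT; split.
    apply/negP => /scs'[|[eq_r _]]; first exact/negP.
    by have := rg_le rg a b; rewrite eq_r ltnn.
  move=> z; rewrite inE => /predU1P[->|/scs'[zcs|[-> Ns]]].
  - by left; rewrite mem_head.
  - by left; rewrite inE zcs orbT.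
  by right; rewrite inE Ns orbT.
elim: m x => [|a m IHm] x /=.
  by move=> _ _; rewrite -cats1; apply: (step _ _ [::] [::]).
case/andP=> x_am uam /andP[xa_cs ucs] /=; rewrite rcons_cat.
have [ucs' scs'] := IHm a uam ucs.
apply: step => // [z|xa]; first exact: pairmap_col_le.
(* A second passage along uv would visit [x], which is [u] or [v], again. *)
apply/negP; rewrite mem_rcons inE => /None_sub_path[uI vI _].
by case/orP: xa x_am => /andP[/eqP-> _]; rewrite ?uI ?vI.
Qed.

Lemma sub_path_uniq x m y : uniq (x :: rcons m y) ->
  uniq (Some x :: rcons (sub_path x m y) (Some y)).
Proof.
have Some_in a m' z : Some z \in rcons (sub_path a m' y) (Some y) ->
    z \in rcons m' y.
  by rewrite !mem_rcons !inE mem_sub_path.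
elim: m x => [|a m IHm] x /=.
  by rewrite !inE !andbT => ne; case: ifP; rewrite /= ?inE ?andbT //=.
case/andP=> x_am uam; rewrite rcons_cat.
have /= um := IHm a uam; case: ifP => [xa|_] /=; last first.
  rewrite um andbT; apply: contra x_am; rewrite !inE.
  by case/predU1P=> [[->]|/Some_in->]; rewrite ?eqxx ?orbT.
rewrite um andbT !inE /=; apply/andP; split.
  apply: contra x_am; rewrite inE.
  by case/predU1P=> [[->]|/Some_in->]; rewrite ?eqxx ?orbT.
apply/negP; rewrite mem_rcons inE => /None_sub_path[uI vI _].
by case/orP: xa x_am => /andP[/eqP-> _]; rewrite ?uI ?vI.
Qed.

Lemma sub_path_rainbow x y m : rainbow_path col x y m ->
  rainbow_path sub_col (Some x) (Some y) (sub_path x m y).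
Proof.
case/and3P=> pm um cm; apply/and3P; split; first exact: sub_path_edges.
  exact: sub_path_uniq.
by case: (sub_path_colours um cm).
Qed.

(** If both paths ran along uv, then [u] and [v] would be common to both, hence be the ends [x] and
    [y]; each path would then be the edge xy alone, against [m1 != m2]. *)
Lemma sub_path_linked x y m1 m2 : linked col x y m1 m2 ->
  linked sub_col (Some x) (Some y) (sub_path x m1 y) (sub_path x m2 y).
Proof.
case/and4P=> r1 r2 ne dj; apply/and4P; split; do ?exact: sub_path_rainbow.
  apply: contra ne => /eqP eq_m; have eq_in z : (z \in m1) = (z \in m2).
    by rewrite -(mem_sub_path x _ y) eq_m mem_sub_path.
  have m2_0 : m2 = [::].
    case: (m2) dj eq_in => // a s /= + /(_ a).
    by rewrite mem_head => /norP[/negPf->].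
  by case: (m1) eq_in => [|a s /(_ a)]; rewrite m2_0 // mem_head.
apply/negP => /hasP[[z|] /=]; rewrite ?mem_sub_path.
  by move=> z2 z1; case/hasP: dj; exists z.
move=> N2 N1; have [u1 v1 _] := None_sub_path N1.
have [u2 v2 _] := None_sub_path N2.
have ends t : t \in x :: rcons m1 y -> t \in x :: rcons m2 y ->
    (t == x) || (t == y).
  rewrite !inE !mem_rcons !inE; case: eqP => //= _; case: eqP => //= _ t1 t2.
  by case/hasP: dj; exists t.
have xy : on_uv x y.
  have [eu|eu] := pred2P (ends u u1 u2); have [ev|ev] := pred2P (ends v v1 v2).
  - by move: neq_uv; rewrite eu ev eqxx.
  - by rewrite /on_uv eu ev !eqxx.
  - by rewrite /on_uv eu ev !eqxx orbT.
  by move: neq_uv; rewrite eu ev eqxx.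
have nil m : rainbow_path col x y m -> None \in sub_path x m y -> m = [::].
  case: m => //= a m /and3P[_ /= /andP[x_am /andP[a_m _]] _].
  rewrite mem_cat; case: ifP => [xa|_ /=].
    have eq_ay : a = y.
      case/orP: xa xy => /andP[/eqP-> /eqP->] /orP[]/andP[/eqP + /eqP] => //.
        by move=> eq_uv; move: neq_uv; rewrite eq_uv eqxx.
      by move=> eq_vu; move: neq_vu; rewrite eq_vu eqxx.
    by rewrite eq_ay mem_rcons mem_head in a_m.
  rewrite inE /= => /None_sub_path[uI vI _].
  by case/orP: xy x_am => /andP[/eqP-> _]; rewrite ?uI ?vI.
by move: ne; rewrite (nil m1) // (nil m2) // eqxx.
Qed.

(** The rainbow cycle through uv passes through [None] after subdivision and stays rainbow. Its edge
    from [u] to [None] is the only one of colour [r.+1]. *)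
Lemma cycle_from_new m : rainbow_path col v u m ->
    col u v \notin pairmap col v (rcons m u) ->
  rainbow_path sub_col None (Some u) (Some v :: map Some m)
  /\ r.+1 \notin pairmap sub_col None (rcons (Some v :: map Some m) (Some u)).
Proof.
move=> rm uv_m; have eq_m x y s : col u v \notin pairmap col x (rcons s y) ->
    sub_path x s y = map Some s.
  elim: s x => [|a s IHs] x /=.
    by rewrite inE; case: ifP => // /on_uv_col->; rewrite eqxx.
  rewrite inE negb_or => /andP[xa as_]; rewrite IHs //.
  by case: ifP xa => // /on_uv_col->; rewrite eqxx.
have rN := sub_path_rainbow rm; rewrite eq_m // in rN.
have cE : pairmap sub_col (Some v) (rcons (map Some m) (Some u))
        = pairmap col v (rcons m u).
  have gen s x : col u v \notin pairmap col x s ->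
      pairmap sub_col (Some x) (map Some s) = pairmap col x s.
    elim: s x => //= a s IHs x; rewrite inE negb_or => /andP[xa /IHs->].
    by case: ifP xa => // /on_uv_col->; rewrite eqxx.
  by rewrite -map_rcons gen.
case/and3P: rN => pN uN cN; split.
  apply/and3P; split.
  - by rewrite /= pN andbT /edge /= neq_vu eqxx; apply: uv.
  - rewrite cons_uniq rcons_cons uN andbT -map_rcons -map_cons.
    by apply/mapP => -[].
  by rewrite /= cE neq_vu eqxx uv_m; case/and3P: rm.
rewrite /= cE neq_vu eqxx inE negb_or.
apply/andP; split; first by apply/eqP; have := rg_le rg u v; lia.
by apply/negP => /pairmap_col_le; rewrite ltnn.
Qed.

Hypothesis cycle_uv : exists m, rainbow_path col v u m
  /\ col u v \notin pairmap col v (rcons m u).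

(** For [x = u] the cycle through [None] is used. Otherwise take two paths from [u] to [x]: in the
    one through [v], [None] replaces [u]; the other is prolonged by the edge from [None] to [u]. *)
Lemma new_linked x : exists m1 m2, linked sub_col None (Some x) m1 m2.
Proof.
have [->|ne] := eqVneq x u.
  have [m [rm um]] := cycle_uv; have [rN _] := cycle_from_new rm um.
  exists (Some v :: map Some m), [::]; rewrite /linked rN /= andbT.
  by rewrite /rainbow_path /= /edge /= !eqxx.
have [|m1 [m2]] := rg_linked rg (x := u) (y := x); first by rewrite eq_sym.
(* [head x m] is the vertex following [u], also when [m] is empty. The two paths leave [u]
   differently, and only [v] and [w] are available. *)
wlog: m1 m2 / head x m1 = v /\ head x m2 != v.
  move=> wl lk; have /and4P[r1 r2 nm dj] := lk.
  have hd m : rainbow_path col u x m -> edge col u (head x m).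
    by case: m => [|h m] /and3P[/= /andP[]].
  have hd_ne : head x m1 != head x m2.
    have no_x m h : rainbow_path col u x (h :: m) -> x != h.
      case/and3P=> _ /= /and3P[_ + _] _; apply: contra => /eqP->.
      by rewrite mem_rcons mem_head.
    case: (m1) (m2) r1 r2 nm dj => [|a s] [|b t] //= r1 r2 _.
    - by move=> _; apply: no_x r2.
    - by move=> _; rewrite eq_sym; apply: no_x r1.
    by case/norP; rewrite inE negb_or eq_sym => /andP[].
  case: (deg_u (hd _ r1)) (deg_u (hd _ r2)) hd_ne => [h1|h1] [h2|h2];
    rewrite ?h1 ?h2 ?eqxx // => vw.
    by apply: (wl m1 m2) => //; rewrite h1 h2 eq_sym.
  by apply: (wl m2 m1); rewrite ?h1 ?h2 //; apply: linkedC.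
case=> h1 h2 /and4P[r1 r2 nm dj].
have avoid a s : u \notin a :: s ->
    path (edge sub_col) (Some a) (map Some s) = path (edge col) a s
    /\ pairmap sub_col (Some a) (map Some s) = pairmap col a s.
  elim: s a => //= b s IHs a; rewrite inE negb_or => /andP[ua ub].
  have [-> ->] := IHs b ub; rewrite /edge /= /on_uv.
  move: ub; rewrite inE negb_or => /andP[ub _].
  by rewrite [a == u]eq_sym [b == u]eq_sym (negPf ua) (negPf ub) andbF.
have rcons_head m : rcons m x = head x m :: behead (rcons m x) by case: m.
have u_notin m : rainbow_path col u x m -> u \notin m.
  by case/and3P=> _ /= /andP[+ _] _; rewrite mem_rcons inE negb_or => /andP[].
exists (map Some m1), (Some u :: map Some m2); apply/and4P; split.
- have := r1; rewrite /rainbow_path -map_rcons rcons_head h1.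
  move: (behead _) => s /and3P[/= /andP[_ ps] /andP[us vs] cs].
  have [pE cE] := avoid _ _ us; apply/and3P; split.
  - by rewrite /= pE ps andbT /edge /= neq_vu eqxx; apply: uv.
  - rewrite /= inE (mem_map (@Some_inj _)) (map_inj_uniq (@Some_inj _)) vs.
    by rewrite andbT; apply/mapP => -[].
  by rewrite /= cE neq_vu eqxx.
- have := r2; rewrite /rainbow_path rcons_cons -map_rcons rcons_head.
  move: h2 (behead _) => /=; move: (head x m2) => h hv s.
  move=> /and3P[/= /andP[uh ps] /andP[us hs] cs].
  have [pE cE] := avoid _ _ us.
  have off : on_uv u h = false by rewrite /on_uv (negPf hv) neq_uv andbF.
  apply/and3P; split.
  - by rewrite /= pE ps /edge /= off eqxx /= andbT.
  - rewrite -map_cons /= !inE !(mem_map (@Some_inj _)) (inj_eq (@Some_inj _)).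
    rewrite (map_inj_uniq (@Some_inj _)) -in_cons us hs /= andbT.
    by apply/mapP => -[].
  rewrite /= cE off eqxx cs andbT; apply/negP => r_in.
  by have := @pairmap_col_le u (h :: s) r.+1 r_in; rewrite ltnn.
- have := u_notin m1 r1; case: (m1) => [|a s] //=; rewrite inE negb_or.
  by case/andP=> ua _; apply: contra ua => /eqP[->].
apply/negP => /hasP[z /=]; rewrite inE => /predU1P[->|].
  by case/mapP=> z1 z1_in [eq_u]; case/negP: (u_notin m1 r1); rewrite eq_u.
case/mapP=> z2 z2_in -> /mapP[z1 z1_in [eq_z]].
by case/hasP: dj; exists z2; rewrite //= eq_z.
Qed.

Lemma card_edges_sub : exists2 es : seq (option T * option T), size es <= e.+1 &
  forall x y, edge sub_col x y -> ((x, y) \in es) || ((y, x) \in es).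
Proof.
have [es es_e cov] := rg_edges rg.
(* At least one entry, for uv, is removed and two are added. *)
pose off := filter (fun p => ~~ on_uv p.1 p.2) es.
exists [:: (None, Some u), (None, Some v)
         & map (fun p => (Some p.1, Some p.2)) off].
  rewrite /= size_map ltnS; apply: leq_trans es_e.
  rewrite size_filter -(count_predC (fun p => on_uv p.1 p.2) es) -add1n.
  rewrite leq_add2r -has_count; apply/hasP.
  case/orP: (cov u v uv) => uv_es; [exists (u, v) | exists (v, u)] => //=.
    by rewrite /on_uv !eqxx.
  by rewrite /on_uv !eqxx orbT.
have new y : edge sub_col None (Some y) -> y = u \/ y = v.
  rewrite /edge /=; case: (y =P u) => [|_]; first by left.
  by case: (y =P v) => //; right.
case=> [x|] [y|] //.
- rewrite /edge /=; case: ifP => // nuv /(cov x y) es_xy.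
  have in_off a b : (a, b) \in es -> ~~ on_uv a b ->
      (Some a, Some b) \in map (fun p => (Some p.1, Some p.2)) off.
    by move=> ab nab; apply/mapP; exists (a, b); rewrite ?mem_filter ?nab.
  case/orP: es_xy => xy_es; apply/orP; [left | right]; rewrite !inE in_off //.
  - by rewrite nuv.
  by rewrite on_uvC nuv.
- by rewrite /edge sub_col_sym => /new[]->; rewrite !inE eqxx !orbT.
by move/new=> -[]->; rewrite !inE eqxx ?orbT.
Qed.

Lemma rainbow_graph_sub : rainbow_graph r.+1 e.+1 sub_col.
Proof.
split.
- exact: sub_col_sym.
- by case=> //= x; rewrite (rg_irr rg); case: ifP.
- exact: sub_col_le.
- case=> [x|] [y|] // ne.
  + have [|m1 [m2 lk]] := rg_linked rg (x := x) (y := y).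
      by apply: contra ne => /eqP->.
    by exists (sub_path x m1 y), (sub_path x m2 y); apply: sub_path_linked.
  + have [m1 [m2 lk]] := new_linked x; exists (rev m1), (rev m2).
    by apply: linked_rev lk; apply: sub_col_sym.
  exact: new_linked.
exact: card_edges_sub.
Qed.

End Subdivision.

(** The next edge to subdivide joins [u] to the new vertex: [None] takes the role of [v], while [u]
    and [w] keep theirs. *)
Lemma subdivide n r e :
  subdividable n r e -> subdividable n.+1 r.+1 e.+1.
Proof.
case=> T [col [cardT rg [u [v [w [m [uv deg_u rm um]]]]]]].
have ne_vu : v != u.
  by apply: contraL uv => /eqP->; rewrite /edge negbK; apply/eqP/(rg_irr rg).
exists (option T), (sub_col col r u v); split.
- by rewrite card_option cardT.
- by apply: (rainbow_graph_sub rg uv deg_u); exists m.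
have [rN cN] := cycle_from_new rg uv rm um.
have new_u : sub_col col r u v (Some u) None = r.+1 by rewrite /= eqxx.
exists (Some u), None, (Some w), (Some v :: map Some m); split=> //.
- by rewrite /edge new_u.
- case=> [x|]; last by left.
  rewrite /edge /= /on_uv eqxx /=; case: (x =P v) => //= ne_xv.
  case: ifP => // _ /deg_u[//|->]; by right.
by rewrite new_u.
Qed.

Lemma template6_subdividable m c : 1 < c < 6 ->
  subdividable (m.+1 * 4 + c.+1) 6 (2 * c - 2 + m.+1 * 8).
Proof.
move=> c_bounds; have ok := template6_ok c_bounds.
exists (tvertex m 3 c), (@tcol m 3 c template6).
have core_lt l : l < 7 -> l < 3 + c.+2 by lia.
pose vtx := @vertex m 3 c ord0.
split; first exact: card_tvertex.
  by rewrite -(size_template6 c_bounds); exact: template_rainbow_graph _ ok.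
have col_uv : tcol template6 (vtx 6) (vtx 5) = 3.
  by rewrite /tcol !code_vertex ?core_lt.
exists (vtx 6), (vtx 5), (vtx 4), [:: vtx 2; vtx 1; vtx 4].
rewrite col_uv; split.
- by rewrite /edge col_uv.
- move=> x; rewrite /edge /tcol code_vertex ?core_lt //=.
  rewrite /ccol /= => /lcol_neq0[e e_in e_ends].
  have x_vtx l : 3 < l -> (code x).2 = l -> x = vtx l.
    move=> l3 xl; rewrite -xl /vtx vertexK //.
    case: x {e_ends} xl => [[k j]|j] //= xl; have := ltn_ord j.
    by rewrite xl ltnNge l3.
  have /allP/(_ e e_in) : all (fun e => ((e.1.1 == 6) ==> (e.1.2 == 5))
                          && ((e.1.2 == 6) ==> (e.1.1 == 4))) template6 by [].
  case/orP: e_ends => /eqP-> /=.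
    by case/andP=> /eqP/x_vtx-> // _; left.
  by case/andP=> _ /eqP/x_vtx-> //; right.
- pose cycle := [:: (0, 5); (1, 2); (1, 1); (0, 4); (0, 6)].
  have sub : {subset cycle <= core_codes 3 c ++ piece_codes 3 1}.
    by apply/allP; rewrite /= !mem_L1 /=; lia.
  have [||inj col_eq] := @place_embedding 6 m 3 c template6 cycles6 ok
      (core_codes 3 c ++ piece_codes 3 1) ord0 ord0.
  - by move=> x xL; rewrite mem_L2 xL.
  - by apply/orP; right; apply/allP => -[i l]; rewrite mem_L1 /=; lia.
  exact: (rainbow_path_map inj col_eq (x := (0, 5)) (y := (0, 6))
            (m := [:: (1, 2); (1, 1); (0, 4)])).
by rewrite /= /tcol !code_vertex ?core_lt.
Qed.

(** * The three bounds *)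

Lemma rainbow_graphW r s e (T : finType) (col : T -> T -> nat) :
  r <= s -> rainbow_graph r e col -> rainbow_graph s e col.
Proof.
move=> rs [cs ci cr lk es]; split=> // x y.
exact: leq_trans (cr x y) rs.
Qed.

Lemma t2_bound3 n r : 3 <= r -> 4 <= n ->
  exists2 t, is_t2 n r t & 2 * t + 10 <= 5 * n.
Proof.
(* With [M.+1] pieces the graph has 2c - 2 + 5(M + 1) edges, and twice this plus 10 equals 5n + 1 -
   c. *)
move=> r3 n4; pose M := (n./2 - 2); pose c := 1 + odd n.
have c_bounds : 0 < c < 3 by rewrite /c; case: odd.
have eq_n : n = M.+1 * 2 + c.+1.
  by have := odd_double_half n; rewrite /M /c; lia.
have := template_rainbow_graph M (template3_ok c_bounds).
move/(rainbow_graphW r3)/rainbow_graph_t2; rewrite card_tvertex -eq_n.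
rewrite size_template3 // => -[|t tmin le_t]; first by lia.
by exists t => //; move: le_t eq_n => /=; lia.
Qed.

Lemma t2_bound5 n : 7 <= n ->
  exists2 t, is_t2 n 5 t & 3 * t + 19 <= 7 * n.
Proof.
(* The smallest core has 4 vertices. Three times the number of edges plus 19 equals 7n + 3 - c. *)
move=> n7; pose M := (n - 4) %/ 3 - 1; pose c := 3 + (n - 4) %% 3.
have c_bounds : 2 < c < 6 by rewrite /c; lia.
have eq_n : n = M.+1 * 3 + c.+1 by rewrite /M /c; lia.
have := template_rainbow_graph M (template5_ok c_bounds).
move/rainbow_graph_t2; rewrite card_tvertex -eq_n.
rewrite size_template5 // => -[|t tmin le_t]; first by lia.
by exists t => //; move: le_t eq_n => /=; lia.
Qed.

Lemma t2_bound6 n r : 6 <= r -> r + 3 <= n ->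
  exists2 t, is_t2 n r t & t + r <= 2 * n + 2.
Proof.
(* After [d] subdivisions, which raise vertices, colours and edges by [d] each, the graph has
   exactly 2n + 2 - r edges. The 3 is the size of the smallest core. *)
move=> r6 rn; pose d := r - 6; pose M := (n - d - 3) %/ 4 - 1.
pose c := 2 + (n - d - 3) %% 4.
have c_bounds : 1 < c < 6 by rewrite /c; lia.
have eq_n : n = M.+1 * 4 + c.+1 + d by rewrite /M /c /d; lia.
have subd k : subdividable (M.+1 * 4 + c.+1 + k) (6 + k)
                           (2 * c - 2 + M.+1 * 8 + k).
  elim: k => [|k IHk]; last by rewrite !(addnS _ k); apply: subdivide.
  by rewrite !addn0; apply: template6_subdividable.
have [T [col [cardT rg _]]] := subd d.
have [|t tmin le_t] := rainbow_graph_t2 _ rg; first by rewrite cardT; lia.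
have eq_r : 6 + d = r by rewrite /d; lia.
move: tmin; rewrite cardT -eq_n eq_r => tmin; exists t => //.
by move: le_t eq_n; lia.
Qed.

Local Open Scope ring_scope.

Theorem theorem3p1 :
  (forall n r : nat, (r = 3 \/ r = 4)%N -> (r + 1 <= n)%N ->
     exists2 t : nat, is_t2 n r t & t%:R <= 5 / 2 * n%:R - 5 :> rat) /\
  (forall n : nat, (7 <= n)%N ->
     exists2 t : nat, is_t2 n 5 t & t%:R <= (7 * n%:R - 19) / 3 :> rat) /\
  (forall n r : nat, (6 <= r)%N -> (r + 3 <= n)%N ->
     exists2 t : nat, is_t2 n r t & t%:R <= 2 * n%:R - r%:R + 2 :> rat).
Proof.
split=> [n r r34 rn|]; last split=> [n n7|n r r6 rn].
- have [||t tmin] := @t2_bound3 n r; [lia | lia |].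
  rewrite -(ler_nat rat) (natrD _ (2 * t)%N) !natrM => le_t.
  by exists t => //; lra.
- have [t tmin] := t2_bound5 n7.
  rewrite -(ler_nat rat) (natrD _ (3 * t)%N) !natrM => le_t.
  by exists t => //; lra.
have [t tmin] := t2_bound6 r6 rn.
rewrite -(ler_nat rat) (natrD _ t) (natrD _ (2 * n)%N) natrM => le_t.
by exists t => //; lra.
Qed.
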